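(* Let $G$ be a finite directed graph with labelled adjacency matrix $\mathsf W$ and monoid of hikes $\mathcal H$. The formal series of the walk Liouville function $\lambda(h):=(-1)^{\Omega(h)}$ satisfies $$\mathcal S\lambda(s)=\sum_{h\in\mathcal H}e^{-s\ell(h)}(-1)^{\Omega(h)}\,h=\frac{1}{\mathrm{perm}(\mathsf I+e^{-s}\mathsf W)},$$ where $\mathrm{perm}$ designates the permanent.
   Context: Let $G=(V,E)$ be a finite directed graph with $V=\{v_1,\dots,v_N\}$ and $E\subseteq V^2$ (loops allowed). Each arc $(v_i,v_j)\in E$ is identified with a formal variable $w_{ij}$, and $\mathsf W=(w_{ij})_{1\le i,j\le N}$ with $w_{ij}=0$ if $(v_i,v_j)\notin E$; $\mathsf I$ is the identity matrix. Let $\mathcal M$ be the trace monoid generated by the arcs, i.e. the quotient of the free monoid on the arcs by the relations $w_{ij}w_{kl}=w_{kl}w_{ij}$ for $i\neq k$ (arcs commute if and only if they start from different vertices); the permanent is computed in the corresponding algebra of formal series (entries from different rows commute). A hike is an element $h=w_{i_1j_1}\cdots w_{i_\ell j_\ell}$ of $\mathcal M$ such that for each $i$, $\#\{k: i_k=i\}=\#\{k: j_k=i\}$; its length is $\ell(h)=\ell$. The hikes form a submonoid $\mathcal H$ of $\mathcal M$, containing the empty hike $1$. A simple cycle is a hike of the form $w_{i_1i_2}w_{i_2i_3}\cdots w_{i_\ell i_1}$ with $\ell\ge1$ and $i_1,\dots,i_\ell$ pairwise distinct. Every hike is a product of simple cycles (its prime factors), uniquely up to exchanging consecutive vertex-disjoint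 simple cycles; $\Omega(h)$ is the number of factors in this product (counted with multiplicity), with $\Omega(1)=0$. For $f:\mathcal H\to\mathbb R$, $\mathcal Sf(s)=\sum_{h\in\mathcal H}e^{-s\ell(h)}f(h)\,h$ ($s$ a complex variable), a formal series over $\mathcal H$; such series are multiplied using the multiplication of $\mathcal H$, and $1/A$ denotes the inverse of the series $A$. *)

(* Defs.v *)
From HB Require Import structures.
From Stdlib Require Import Relation_Operators.
From mathcomp Require Import all_boot all_order all_fingroup all_algebra.
From mathcomp Require Import all_classical reals sequences exp trigo.
From mathcomp Require Import generic_quotient.
From mathcomp.real_closed Require Import complex.

Set Implicit Arguments.
Unset Strict Implicit.
Unset Printing Implicit Defensive.
Import GRing.Theory.
Local Open Scope quotient_scope.
Local Open Scope classical_set_scope.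
Local Open Scope ring_scope.
Local Open Scope complex_scope.

(** * The trace monoid of the arcs of a digraph *)

Section TraceMonoid.
Variables (N : nat) (E : {set 'I_N * 'I_N}).

Definition arc := {a : 'I_N * 'I_N | a \in E}.
HB.instance Definition _ := Finite.on arc.

Definition source (a : arc) : 'I_N := (val a).1.
Definition target (a : arc) : 'I_N := (val a).2.

Definition swap (u v : seq arc) : Prop :=
  exists x y a b, [/\ source a != source b,
    u = x ++ [:: a; b] ++ y & v = x ++ [:: b; a] ++ y].

(* Swaps happen inside arbitrary words, so their equivalence closure is the
   congruence generated by the commutation relations. *)
Definition trace_equiv : seq arc -> seq arc -> Prop :=
  clos_refl_sym_trans (seq arc) swap.

Definition trace_eqb : rel (seq arc) := fun u v => `[< trace_equiv u v >].

Lemma trace_eqb_refl : reflexive trace_eqb.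
Proof. by move=> u; apply/asboolP; exact: rst_refl. Qed.

Lemma trace_eqb_sym : symmetric trace_eqb.
Proof. by move=> u v; apply/asboolP/asboolP; exact: rst_sym. Qed.

Lemma trace_eqb_trans : transitive trace_eqb.
Proof.
by move=> v u w /asboolP uv /asboolP vw; apply/asboolP; exact: rst_trans uv vw.
Qed.

Canonical trace_eqb_equiv :=
  EquivRel trace_eqb trace_eqb_refl trace_eqb_sym trace_eqb_trans.

Definition trace := {eq_quot trace_eqb}.
HB.instance Definition _ := Choice.on trace.
HB.instance Definition _ := EqQuotient.on trace.

Lemma trace_piP (u v : seq arc) :
  reflect (trace_equiv u v) (\pi_trace u == \pi_trace v).
Proof. by rewrite eqmodE; exact: asboolP. Qed.

Lemma trace_reprP (u : seq arc) : trace_equiv (repr (\pi_trace u)) u.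
Proof. by apply/trace_piP; rewrite reprK. Qed.

Lemma trace_equiv_cat (u u' v v' : seq arc) :
  trace_equiv u u' -> trace_equiv v v' -> trace_equiv (u ++ v) (u' ++ v').
Proof.
move=> uu' vv'; apply: (rst_trans _ _ _ (u' ++ v)).
  elim: uu' => {u u'} [_ _ [x [y [a [b [ab -> ->]]]]]|u|u w _|u w z _ + _].
  - by apply: rst_step; exists x, (y ++ v), a, b; rewrite -!catA.
  - exact: rst_refl.
  - exact: rst_sym.
  - exact: rst_trans.
elim: vv' => {v v'} [_ _ [x [y [a [b [ab -> ->]]]]]|v|v w _|v w z _ + _].
- by apply: rst_step; exists (u' ++ x), y, a, b; rewrite -!catA.
- exact: rst_refl.
- exact: rst_sym.
- exact: rst_trans.
Qed.

Definition trace_one : trace := \pi_trace [::].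
Definition trace_mul (x y : trace) : trace := \pi_trace (repr x ++ repr y).

Lemma trace_mul_pi (u v : seq arc) :
  trace_mul (\pi_trace u) (\pi_trace v) = \pi_trace (u ++ v).
Proof. by apply/eqP/trace_piP/trace_equiv_cat; exact: trace_reprP. Qed.

Lemma trace_mulA : associative trace_mul.
Proof.
elim/quotW=> u; elim/quotW=> v; elim/quotW=> w.
rewrite (trace_mul_pi v w) (trace_mul_pi u v).
by rewrite (trace_mul_pi u (v ++ w)) (trace_mul_pi (u ++ v) w) catA.
Qed.

Lemma trace_mul1 : left_id trace_one trace_mul.
Proof. by elim/quotW=> u; rewrite trace_mul_pi. Qed.

Lemma trace_mulr1 : right_id trace_one trace_mul.
Proof. by elim/quotW=> u; rewrite trace_mul_pi cats0. Qed.

HB.instance Definition _ :=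
  isMonoid.Build trace trace_mulA trace_mul1 trace_mulr1.

Definition word_trace (w : seq arc) : trace := \pi_trace w.

Lemma word_traceM (u v : seq arc) :
  (word_trace u * word_trace v)%g = word_trace (u ++ v).
Proof. exact: trace_mul_pi. Qed.

Lemma trace_equiv_perm (u v : seq arc) : trace_equiv u v -> perm_eq u v.
Proof.
elim=> {u v} [_ _ [x [y [a [b [_ -> ->]]]]]|//|u v _|u v w _ + _].
- by rewrite perm_cat2l perm_cat2r (perm_catC [:: a] [:: b]).
- by rewrite perm_sym.
- exact: perm_trans.
Qed.

Lemma trace_repr_perm (w : seq arc) : perm_eq (repr (word_trace w)) w.
Proof. exact/trace_equiv_perm/trace_reprP. Qed.

Definition ell (x : trace) : nat := size (repr x).

Lemma ell_word (w : seq arc) : ell (word_trace w) = size w.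
Proof. exact/perm_size/trace_repr_perm. Qed.

Lemma ellM (x y : trace) : ell (x * y)%g = (ell x + ell y)%N.
Proof.
elim/quotW: x => u; elim/quotW: y => v.
by rewrite -!/(word_trace _) word_traceM !ell_word size_cat.
Qed.

(** * Hikes *)

Definition is_hike : {pred trace} := fun x =>
  [forall i, count [pred a | source a == i] (repr x)
          == count [pred a | target a == i] (repr x)].

Lemma is_hike_word (w : seq arc) :
  (word_trace w \in is_hike) =
  [forall i, count [pred a | source a == i] w
          == count [pred a | target a == i] w].
Proof.
by apply: eq_forallb => i; rewrite !(seq.permP (trace_repr_perm w)).
Qed.

Lemma is_hike1 : (1 : trace)%g \in is_hike.
Proof. by rewrite [1%g]/(word_trace [::]) is_hike_word; apply/forallP. Qed.

Lemma is_hikeM : {in is_hike &, forall x y, (x * y)%g \in is_hike}.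
Proof.
elim/quotW=> u; elim/quotW=> v.
rewrite -!/(word_trace _) word_traceM !is_hike_word.
move=> /forallP hu /forallP hv; apply/forallP => i.
by rewrite !count_cat (eqP (hu i)) (eqP (hv i)).
Qed.

Lemma is_hike_umagma_closed : umagma_closed is_hike.
Proof. by split; [exact: is_hike1|exact: is_hikeM]. Qed.

Record hike := Hike { hike_trace :> trace; _ : hike_trace \in is_hike }.
HB.instance Definition _ := [isSub for hike_trace].
HB.instance Definition _ := [Choice of hike by <:].
HB.instance Definition _ := SubChoice_isSubMonoid.Build trace is_hike hike
  is_hike_umagma_closed.

(* [w] lists the arcs w_{i1 i2}, w_{i2 i3}, ..., w_{il i1}: the targets are the
   sources shifted by one place, cyclically. *)
Definition simple_cycle (c : trace) : Prop :=
  exists w : seq arc, [/\ w != [::], uniq (map source w),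
    map target w = rot 1 (map source w) & c = word_trace w].

Definition prime_factorization (h : hike) (cs : seq trace) : Prop :=
  (forall c, c \in cs -> simple_cycle c) /\ (\prod_(c <- cs) c)%g = h :> trace.

(* Prime factorizations exist and are unique up to exchanging consecutive
   vertex-disjoint cycles, so the size does not depend on the one chosen. *)
Definition Omega (h : hike) : nat :=
  size (xget [::] [set cs | prime_factorization h cs]).

End TraceMonoid.

(** * Formal series over the trace monoid *)

Section Series.
Variables (K : comNzRingType) (N : nat) (E : {set 'I_N * 'I_N}).
Local Notation M := (trace E).

Definition formal_series := M -> K.
HB.instance Definition _ := GRing.Zmodule.copy formal_series (M -> K).

Lemma seriesD (f g : formal_series) (m : M) : (f + g) m = f m + g m.
Proof. by []. Qed.

Definition series_scale (k : K) (f : formal_series) : formal_series :=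
  fun m => k * f m.

Lemma series_scaleA (k l : K) (f : formal_series) :
  series_scale k (series_scale l f) = series_scale (k * l) f.
Proof. by apply/funext => m; exact: mulrA. Qed.

Lemma series_scale1 : left_id 1 series_scale.
Proof. by move=> f; apply/funext => m; exact: mul1r. Qed.

Lemma series_scaleDr : right_distributive series_scale +%R.
Proof. by move=> k f g; apply/funext => m; exact: mulrDr. Qed.

Lemma series_scaleDl (f : formal_series) :
  {morph series_scale^~ f : k l / k + l}.
Proof. by move=> k l; apply/funext => m; exact: mulrDl. Qed.

HB.instance Definition _ := GRing.Zmodule_isLmodule.Build K formal_series
  series_scaleA series_scale1 series_scaleDr series_scaleDl.

Lemma seriesZ (k : K) (f : formal_series) (m : M) : (k *: f) m = k * f m.
Proof. by []. Qed.

Definition monomial (m : M) : formal_series := fun x => (x == m)%:R.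

Definition factors (m : M) : set (M * M) := [set p | (p.1 * p.2)%g = m].

(* A finite sum, by [finite_factors]. *)
Definition series_mul (f g : formal_series) : formal_series :=
  fun m => \sum_(p \in factors m) f p.1 * g p.2.

Definition trace_ball (n : nat) : seq M :=
  undup [seq word_trace (val w) | w : n.-bseq (arc E)].

Lemma trace_ball_mem (n : nat) (m : M) : (m \in trace_ball n) = (ell m <= n)%N.
Proof.
rewrite mem_undup; apply/fintype.imageP/idP => [[w _ ->]|le_mn].
  by rewrite ell_word; exact: size_bseq.
by exists (Bseq le_mn) => //=; rewrite -[LHS]reprK.
Qed.

Lemma trace_ball_uniq (n : nat) : uniq (trace_ball n).
Proof. exact: undup_uniq. Qed.

Lemma factors_ball (n : nat) (m : M) : (ell m <= n)%N ->
  factors m =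
  [set` [seq p <- [seq (u, v) | u <- trace_ball n, v <- trace_ball n]
        | (p.1 * p.2)%g == m]].
Proof.
move=> le_mn; apply/seteqP; split=> -[u v] /=; rewrite mem_filter /factors /=.
  move=> uv; rewrite uv eqxx /=; apply/allpairsP; exists (u, v) => /=.
  rewrite !trace_ball_mem; split=> //; apply: leq_trans le_mn; rewrite -uv ellM.
    exact: leq_addr.
  exact: leq_addl.
by case/andP => /eqP.
Qed.

Lemma finite_factors (m : M) : finite_set (factors m).
Proof. rewrite (factors_ball (leqnn _)); exact: finite_seq. Qed.

Lemma series_mulE (n : nat) (f g : formal_series) (m : M) : (ell m <= n)%N ->
  series_mul f g m =
  \sum_(u <- trace_ball n) \sum_(v <- trace_ball n | (u * v)%g == m) f u * g v.
Proof.
move=> le_mn; rewrite /series_mul (factors_ball le_mn) -fsbig_seq; last first.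
  rewrite filter_uniq // allpairs_uniq ?trace_ball_uniq //.
  by move=> [? ?] [? ?].
rewrite big_filter big_mkcond big_allpairs /=.
by apply: eq_bigr => u _; rewrite -big_mkcond.
Qed.

Lemma ball_collapse (n : nat) (c : M) (P : pred M) (x : K) :
  (P c -> (ell c <= n)%N) ->
  \sum_(v <- trace_ball n) (if P v && (c == v) then x else 0) =
  if P c then x else 0.
Proof.
move=> Pn; case: ifPn => [Pc|nPc]; last first.
  by apply: big1 => v _; case: eqP => [<-|_]; rewrite ?(negbTE nPc) ?andbF.
rewrite (bigD1_seq c) ?trace_ball_mem ?trace_ball_uniq ?Pn //= Pc eqxx.
rewrite big1 ?addr0 // => v.
by rewrite eq_sym => /negbTE ->; rewrite andbF.
Qed.

Lemma ball_pred1 (n : nat) (m : M) (F : M -> K) : (ell m <= n)%N ->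
  \sum_(v <- trace_ball n | v == m) F v = F m.
Proof.
move=> mn; rewrite big_mkcond.
rewrite (bigD1_seq m) ?trace_ball_mem ?trace_ball_uniq //= eqxx.
by rewrite big1 ?addr0 // => v /negbTE ->.
Qed.

Lemma series_mulA : associative series_mul.
Proof.
move=> f g h; apply/funext => m; set n := ell m.
rewrite !(@series_mulE n) //.
transitivity (\sum_(u <- trace_ball n) \sum_(a <- trace_ball n)
    \sum_(b <- trace_ball n)
    (if (u * (a * b))%g == m then f u * (g a * h b) else 0)).
  apply: eq_bigr => u _; rewrite big_mkcond /=.
  transitivity (\sum_(v <- trace_ball n) \sum_(a <- trace_ball n)
    \sum_(b <- trace_ball n)
    (if ((u * v)%g == m) && ((a * b)%g == v) then f u * (g a * h b) else 0)).
    apply: eq_bigr => v _; case: ifPn => [/eqP uv|_]; last first.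
      by rewrite big1 // => a _; rewrite big1.
    rewrite (@series_mulE n) ?mulr_sumr; last by rewrite /n -uv ellM leq_addl.
    by apply: eq_bigr => a _; rewrite mulr_sumr big_mkcond.
  rewrite exchange_big /=; apply: eq_bigr => a _.
  rewrite exchange_big /=; apply: eq_bigr => b _.
  apply: (@ball_collapse n (a * b)%g (fun v => (u * v)%g == m)).
  by move/eqP=> uab; rewrite /n -uab [leqRHS]ellM leq_addl.
transitivity (\sum_(v <- trace_ball n) \sum_(u <- trace_ball n)
    \sum_(a <- trace_ball n)
    \sum_(b <- trace_ball n)
    (if ((v * b)%g == m) && ((u * a)%g == v) then f u * g a * h b : K else 0)).
  rewrite [RHS]exchange_big /=; apply: eq_bigr => u _.
  rewrite [RHS]exchange_big /=; apply: eq_bigr => a _.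
  rewrite [RHS]exchange_big /=; apply: eq_bigr => b _.
  rewrite mulgA mulrA; symmetry.
  apply: (@ball_collapse n (u * a)%g (fun v => (v * b)%g == m)).
  by move/eqP=> uab; rewrite /n -uab [leqRHS]ellM leq_addr.
apply: eq_bigr => v _.
under eq_bigr do rewrite exchange_big /=.
rewrite exchange_big /= [RHS]big_mkcond /=; apply: eq_bigr => b _.
case: ifPn => [/eqP vb|_]; last by rewrite big1 // => u _; rewrite big1.
rewrite (@series_mulE n) ?mulr_suml; last by rewrite /n -vb ellM leq_addr.
by apply: eq_bigr => u _; rewrite mulr_suml [RHS]big_mkcond.
Qed.

Lemma series_mul1 : left_id (monomial 1%g) series_mul.
Proof.
move=> f; apply/funext => m; rewrite (@series_mulE (ell m)) //.
rewrite (bigD1_seq 1%g) ?trace_ball_uniq ?trace_ball_mem //=; last first.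
  by rewrite [1%g]/(word_trace [::]) ell_word.
rewrite [X in _ + X]big1 ?addr0 => [|u /negbTE u1]; last first.
  by rewrite big1 // => v _; rewrite /monomial u1 mul0r.
under eq_bigl do rewrite mul1g.
by rewrite ball_pred1 // /monomial eqxx mul1r.
Qed.

Lemma series_mulr1 : right_id (monomial 1%g) series_mul.
Proof.
move=> f; apply/funext => m; rewrite (@series_mulE (ell m)) //.
under eq_bigr do rewrite big_mkcond /=; rewrite exchange_big /=.
rewrite (bigD1_seq 1%g) ?trace_ball_uniq ?trace_ball_mem //=; last first.
  by rewrite [1%g]/(word_trace [::]) ell_word.
rewrite [X in _ + X]big1 ?addr0 => [|u /negbTE u1]; last first.
  by rewrite big1 // => v _; rewrite /monomial u1 mulr0 if_same.
under eq_bigr do rewrite mulg1; rewrite -big_mkcond /=.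
by rewrite ball_pred1 // /monomial eqxx mulr1.
Qed.

Lemma series_mulDl : left_distributive series_mul +%R.
Proof.
move=> f g h; apply/funext => m.
rewrite seriesD !(@series_mulE (ell m)) //.
rewrite -big_split; apply: eq_bigr => u _ /=.
by rewrite -big_split; apply: eq_bigr => v _; exact: mulrDl.
Qed.

Lemma series_mulDr : right_distributive series_mul +%R.
Proof.
move=> f g h; apply/funext => m.
rewrite seriesD !(@series_mulE (ell m)) //.
rewrite -big_split; apply: eq_bigr => u _ /=.
by rewrite -big_split; apply: eq_bigr => v _; exact: mulrDr.
Qed.

Lemma series_oner_neq0 : monomial 1%g != 0.
Proof.
apply/eqP => /(congr1 (@^~ 1%g)); rewrite /monomial eqxx => /eqP.
by rewrite [X in _ == X]/(0 : K) oner_eq0.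
Qed.

HB.instance Definition _ := GRing.Zmodule_isNzRing.Build formal_series
  series_mulA series_mul1 series_mulr1 series_mulDl series_mulDr
  series_oner_neq0.

Lemma seriesME (n : nat) (f g : formal_series) (m : M) : (ell m <= n)%N ->
  (f * g) m =
  \sum_(u <- trace_ball n) \sum_(v <- trace_ball n | (u * v)%g == m) f u * g v.
Proof. exact: series_mulE. Qed.

Lemma series_scaleAl (k : K) (f g : formal_series) :
  k *: (f * g) = (k *: f) * g.
Proof.
apply/funext => m; rewrite seriesZ !(@seriesME (ell m)) // mulr_sumr.
apply: eq_bigr => u _; rewrite mulr_sumr; apply: eq_bigr => v _.
by rewrite seriesZ mulrA.
Qed.

HB.instance Definition _ :=
  GRing.Lmodule_isLalgebra.Build K formal_series series_scaleAl.

Lemma series_scaleAr (k : K) (f g : formal_series) :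
  k *: (f * g) = f * (k *: g).
Proof.
apply/funext => m; rewrite seriesZ !(@seriesME (ell m)) // mulr_sumr.
apply: eq_bigr => u _; rewrite mulr_sumr; apply: eq_bigr => v _.
by rewrite seriesZ mulrCA.
Qed.

HB.instance Definition _ :=
  GRing.Lalgebra_isAlgebra.Build K formal_series series_scaleAr.

Definition series_unit : {pred formal_series} :=
  fun f => `[< exists g : formal_series, g * f = 1 /\ f * g = 1 >].

Definition series_inv (f : formal_series) : formal_series :=
  xget f [set g | g * f = 1 /\ f * g = 1].

Lemma series_invP (f : formal_series) : f \in series_unit ->
  series_inv f * f = 1 /\ f * series_inv f = 1.
Proof.
by move=> /asboolP[g fg]; rewrite /series_inv; case: xgetP => [? -> //|/(_ g)].
Qed.

Lemma series_mulVf : {in series_unit, left_inverse 1 series_inv *%R}.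
Proof. by move=> f /series_invP[]. Qed.

Lemma series_divff : {in series_unit, right_inverse 1 series_inv *%R}.
Proof. by move=> f /series_invP[]. Qed.

Lemma series_unitP (f g : formal_series) :
  g * f = 1 /\ f * g = 1 -> f \in series_unit.
Proof. by move=> fg; apply/asboolP; exists g. Qed.

Lemma series_inv_out : {in [predC series_unit], series_inv =1 id}.
Proof.
move=> f /negP nf; rewrite /series_inv; case: xgetP => [g _ fg|//].
by case: nf; apply: (series_unitP fg).
Qed.

HB.instance Definition _ := GRing.NzRing_hasMulInverse.Build formal_series
  series_mulVf series_divff series_unitP series_inv_out.

(* The series [\sum_h c h h] over hikes, as a series over the trace monoid that
   vanishes off the hikes. *)
Definition hike_series (c : hike E -> K) : formal_series :=
  fun m => if insub m is Some h then c h else 0.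

Definition adjacency : 'M[formal_series]_N :=
  \matrix_(i, j)
    if insub (i, j) is Some a then monomial (word_trace [:: a]) else 0.

End Series.

(* Each product is taken in increasing order of the rows; the order does not
   matter when entries from different rows commute. *)
Definition permanent (S : nzRingType) (n : nat) (A : 'M[S]_n) : S :=
  \sum_(s : 'S_n) \prod_(i < n) A i (s i).

(** * Dirichlet series of functions on hikes *)

Section Dirichlet.
Variable R : realType.

Definition cexp (z : R[i]) : R[i] :=
  (expR (Re z))%:C * (cos (Im z) +i* sin (Im z)).

Variables (N : nat) (E : {set 'I_N * 'I_N}).

Definition dirichlet (f : hike E -> R) (s : R[i]) : formal_series R[i] E :=
  hike_series (fun h => cexp (- s * (ell h)%:R) * (f h)%:C).

Definition liouville (h : hike E) : R := (-1) ^+ Omega h.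

End Dirichlet.

(* Main.v *)
Require Import Defs.
From Stdlib Require Import Relation_Operators.
From mathcomp Require Import all_boot all_order all_fingroup all_algebra.
From mathcomp Require Import all_classical reals exp trigo.
From mathcomp Require Import generic_quotient.
From mathcomp.real_closed Require Import complex.
From mathcomp Require Import ring.
From mathcomp Require Import seq fintype finset fingraph.
Set Implicit Arguments.
Unset Strict Implicit.
Unset Printing Implicit Defensive.
Import GRing.Theory.
Local Open Scope quotient_scope.
Local Open Scope ring_scope.
Local Open Scope complex_scope.

(* Two arcs commute iff their sources differ, so a trace is the family of its
   rows, the row of [i] being the word of its arcs leaving [i].  The permanent
   [P] is the sum of [z^l(v) v] over the hikes [v] with at most one arc in each
   row, i.e. the products of vertex-disjoint simple cycles.

   The constant term of [P] is 1, so [P] has an inverse [Q].  The last arcs of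
   the rows of a trace [h] define a partial map [f] on vertices, and the
   factorizations [h = u v] with [v] as above correspond to the vertex sets [S]
   with [f(S) = S].  If the simple cycle [c] with vertex set [C] divides [h] on
   the right, every such [S] contains [C] or is disjoint from it.  Pairing [S]
   with [S u C] in [(Q P)(h) = 0] gives [Q(u c) = - z^l(c) Q(u)] by induction on
   the length of [u], hence [Q(h) = (-1)^k z^l(h)] for every factorization of
   [h] into [k] simple cycles; in particular the parity of [k] is the same for
   all factorizations. *)

(** * Traces as families of rows, and splitting off last arcs *)

Section Rows.
Variables (N : nat) (E : {set 'I_N * 'I_N}).
Implicit Types (i j : 'I_N) (u v w : seq (Defs.arc E)) (m h x y : trace E).
Implicit Types S C : {set 'I_N}.

Lemma trace_equiv_front (v1 v2 : seq (Defs.arc E)) (a : Defs.arc E) :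
  {in v1, forall b, source b != source a} ->
  trace_equiv (v1 ++ a :: v2) (a :: v1 ++ v2).
Proof.
elim: v1 => [|b v1 IH] H /=; first exact: rst_refl.
apply: (rst_trans _ _ _ (b :: a :: v1 ++ v2)).
  apply: (@trace_equiv_cat _ _ [:: b] [:: b]); first exact: rst_refl.
  by apply: IH => c cv; apply: H; rewrite inE cv orbT.
apply: rst_step; exists [::], (v1 ++ v2), b, a; split=> //.
by apply: H; rewrite mem_head.
Qed.

Lemma filter_none (T : eqType) (p : pred T) (w : seq T) :
  {in w, forall b, ~~ p b} -> [seq b <- w | p b] = [::].
Proof.
move=> wp; apply/eqP; rewrite -(negbK (_ == _)) -has_filter.
exact/hasPn.
Qed.

(** The first arc [a] of [u] is also the first arc of its row in [v]. Everything before it in [v]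
    has another source, so [a] can be moved to the front of [v] and cancelled. *)
Lemma trace_equiv_filter u v :
  (forall i, [seq a <- u | source a == i] = [seq a <- v | source a == i]) ->
  trace_equiv u v.
Proof.
elim: u v => [|a u IH] v uv.
  case: v uv => [|b v] uv; first exact: rst_refl.
  by have := uv (source b); rewrite /= eqxx.
have av : a \in v.
  have : a \in [seq b <- v | source b == source a].
    by rewrite -uv /= eqxx mem_head.
  by rewrite mem_filter => /andP[].
have hasv : has (fun b => source b == source a) v by apply/hasP; exists a.
move: uv av; case: (split_find hasv) => b v1 v2 ba /hasPn v1a uv _.
have {ba} ab : a = b.
  have := uv (source a); rewrite /= eqxx cat_rcons filter_cat /= ba.
  by rewrite (filter_none v1a); case.
subst b; rewrite cat_rcons.
apply: rst_sym; apply: (rst_trans _ _ _ (a :: v1 ++ v2)).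
  exact: trace_equiv_front.
apply: (@trace_equiv_cat _ _ [:: a] [:: a]); first exact: rst_refl.
apply: rst_sym; apply: IH => i; have := uv i.
rewrite cat_rcons !filter_cat /=; case: eqP => [<-|//].
by rewrite (filter_none v1a); case.
Qed.

Definition arcs_from i m : seq (Defs.arc E) :=
  [seq a <- repr m | source a == i].

Lemma filter_trace_equiv i u v : trace_equiv u v ->
  [seq a <- u | source a == i] = [seq a <- v | source a == i].
Proof.
elim=> {u v} [_ _ [x [y [a [b [ab -> ->]]]]]|//|//|u v w _ uv _ vw]; last first.
  by rewrite uv.
rewrite !filter_cat; congr (_ ++ (_ ++ _)) => /=.
by case: eqP => [ai|//]; case: eqP => // bi; rewrite ai bi eqxx in ab.
Qed.

Lemma arcs_from_word i w :
  arcs_from i (word_trace w) = [seq a <- w | source a == i].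
Proof. exact/filter_trace_equiv/trace_reprP. Qed.

Lemma trace_rowsP x y : (forall i, arcs_from i x = arcs_from i y) -> x = y.
Proof.
move=> xy; rewrite -[x]reprK -[y]reprK.
by apply/eqP/trace_piP/trace_equiv_filter => i; exact: xy.
Qed.

Lemma arcs_fromM i x y : arcs_from i (x * y)%g = arcs_from i x ++ arcs_from i y.
Proof.
elim/quotW: x => u; elim/quotW: y => v.
by rewrite -!/(word_trace _) word_traceM !arcs_from_word filter_cat.
Qed.

Lemma arcs_from1 i : arcs_from i (1%g : trace E) = [::].
Proof. exact: (arcs_from_word i [::]). Qed.

Lemma source_arcs_from i m : all (fun a => source a == i) (arcs_from i m).
Proof. exact: filter_all. Qed.

Lemma filter_source i j w : all (fun a => source a == j) w ->
  [seq a <- w | source a == i] = if i == j then w else [::].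
Proof.
case: eqP => [-> /all_filterP // | ij /allP wj].
by apply: filter_none => a /wj /eqP ->; rewrite eq_sym; apply/eqP.
Qed.

(** Row by row this is cancellation of a common suffix: the rows of [x] and [y] have equal lengths,
    so both concatenations split at the same place. *)
Lemma trace_mulIg x y m : (x * m = y * m)%g -> x = y.
Proof.
move=> xy; apply: trace_rowsP => i.
have := congr1 (arcs_from i) xy; rewrite !arcs_fromM => /eqP.
have sz : size (arcs_from i x) = size (arcs_from i y).
  have /(congr1 (fun m => size (arcs_from i m))) := xy.
  by rewrite !arcs_fromM !size_cat => /addIn.
by rewrite eqseq_cat // => /andP[/eqP].
Qed.

(** The order in [enum] is immaterial, since arcs of different rows commute, as long as every arc of
    [F i] starts at [i]. *)
Definition of_rows (F : 'I_N -> seq (Defs.arc E)) : trace E :=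
  word_trace (flatten [seq F i | i <- enum 'I_N]).

Lemma arcs_from_of_rows F i : (forall i, all (fun a => source a == i) (F i)) ->
  arcs_from i (of_rows F) = F i.
Proof.
move=> HF; rewrite arcs_from_word filter_flatten -map_comp.
rewrite (_ : map _ (enum 'I_N) =
    [seq if i == j then F i else [::] | j <- enum 'I_N]); last first.
  apply: eq_map => j /=; rewrite (filter_source i (HF j)).
  by case: eqP => // ->.
have : i \in enum 'I_N by rewrite mem_enum.
move: (enum_uniq 'I_N); elim: (enum 'I_N) => //= j s IH /andP[js us].
rewrite inE => /predU1P[ij|si]; last first.
  rewrite ifN ?IH //; apply: contra js; by move/eqP=> <-.
subst j; rewrite eqxx (_ : flatten _ = [::]) ?cats0 //.
elim: s js {IH us} => //= j s IH; rewrite inE negb_or => /andP[ij js].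
by rewrite (negbTE ij) IH.
Qed.

Lemma ell_rows m : ell m = (\sum_i size (arcs_from i m))%N.
Proof.
rewrite /ell -sum1_size (partition_big (@source N E) xpredT) //=.
by apply: eq_bigr => i _; rewrite -big_filter sum1_size.
Qed.

Lemma ell_eq0 m : (ell m == 0%N) = (m == 1%g).
Proof.
apply/eqP/eqP => [|->]; last by rewrite [1%g]/(word_trace [::]) ell_word.
by rewrite -{2}[m]reprK => /size0nil ->.
Qed.

Lemma ell1 : ell (1%g : trace E) = 0%N.
Proof. by apply/eqP; rewrite ell_eq0. Qed.

Definition supp m : {set 'I_N} := [set i | arcs_from i m != [::]].

Lemma supp_eq0 m : (supp m == set0) = (m == 1%g).
Proof.
apply/eqP/eqP => [m0|->]; last first.
  by apply/setP => i; rewrite !inE arcs_from1.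
apply: trace_rowsP => i; rewrite arcs_from1; apply/eqP.
by have /setP/(_ i) := m0; rewrite !inE => /negbFE.
Qed.

(* The target of the last arc leaving [i]; the junk value [i] when there is none
   makes the absent rows of [v] the fixed points of a permutation. *)
Definition next_vertex m i : 'I_N := last i [seq target a | a <- arcs_from i m].

(** The word [drop (size s).-1 s] is the last letter of [s], or empty when [s] is. Together with
    [rest_rows] this is the factorization of [h] attached to the vertex set [S]. *)
Definition top_rows h S : trace E :=
  of_rows (fun i => if i \in S
    then drop (size (arcs_from i h)).-1 (arcs_from i h) else [::]).

Definition rest_rows h S : trace E :=
  of_rows (fun i => if i \in S
    then take (size (arcs_from i h)).-1 (arcs_from i h) else arcs_from i h).

Lemma arcs_from_top h S i : arcs_from i (top_rows h S) =
  if i \in S then drop (size (arcs_from i h)).-1 (arcs_from i h) else [::].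
Proof.
rewrite arcs_from_of_rows // => j; case: ifP => // _.
have := source_arcs_from j h.
rewrite -{1}(cat_take_drop (size (arcs_from j h)).-1 (arcs_from j h)) all_cat.
by case/andP.
Qed.

Lemma arcs_from_rest h S i : arcs_from i (rest_rows h S) =
  if i \in S then take (size (arcs_from i h)).-1 (arcs_from i h)
  else arcs_from i h.
Proof.
rewrite arcs_from_of_rows // => j; have := source_arcs_from j h.
case: ifP => // _.
rewrite -{1}(cat_take_drop (size (arcs_from j h)).-1 (arcs_from j h)) all_cat.
by case/andP.
Qed.

Lemma rest_topK h S : (rest_rows h S * top_rows h S)%g = h.
Proof.
apply: trace_rowsP => i; rewrite arcs_fromM arcs_from_top arcs_from_rest.
by case: ifP; rewrite ?cat_take_drop ?cats0.
Qed.

Lemma supp_top h S : S \subset supp h -> supp (top_rows h S) = S.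
Proof.
move=> /subsetP Sh; apply/setP => i; rewrite inE arcs_from_top.
case: ifP => // /Sh; rewrite inE -!size_eq0 size_drop -!lt0n => h0.
by rewrite subn_gt0 ltn_predL h0.
Qed.

Lemma size_top h S i : (size (arcs_from i (top_rows h S)) <= 1)%N.
Proof.
rewrite arcs_from_top; case: ifP => // _; rewrite size_drop.
by case: (size _) => //= n; rewrite subSnn.
Qed.

Lemma last_drop_pred (T : Type) (x : T) (s : seq T) :
  last x (drop (size s).-1 s) = last x s.
Proof.
by case/lastP: s => // s y; rewrite size_rcons -cats1 drop_size_cat // last_cat.
Qed.

Lemma next_top h S i :
  next_vertex (top_rows h S) i = if i \in S then next_vertex h i else i.
Proof.
rewrite /next_vertex arcs_from_top; case: ifP => // _.
by rewrite map_drop -(size_map (@target N E)) last_drop_pred.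
Qed.

End Rows.

(** * Sets of vertices permuted by the last arcs, and simple cycles *)

Section Cycles.
Variables (N : nat) (E : {set 'I_N * 'I_N}).
Implicit Types (i j : 'I_N) (w : seq (Defs.arc E)) (h u v c m : trace E).
Implicit Types S C : {set 'I_N}.

Lemma next_vertex_out m i : i \notin supp m -> next_vertex m i = i.
Proof. by rewrite inE negbK /next_vertex => /eqP ->. Qed.

Lemma next_vertexM u v i : i \in supp v ->
  next_vertex (u * v)%g i = next_vertex v i.
Proof.
rewrite inE /next_vertex arcs_fromM map_cat last_cat.
by case: (arcs_from i v).
Qed.

Lemma suppM u v : supp (u * v)%g = supp u :|: supp v.
Proof.
apply/setP => i.
by rewrite !inE arcs_fromM -!size_eq0 size_cat addn_eq0 negb_and.
Qed.

(** By finiteness [next_vertex h] permutes [S], so the last arcs of the rows in [S] form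
    vertex-disjoint simple cycles. *)
Definition cyclic_set h S := (S \subset supp h) && (next_vertex h @: S == S).

(** Injectivity is asked on all vertices: empty rows are fixed points, so it also forbids an arc
    from leaving the support. These traces are the products of vertex-disjoint simple cycles. *)
Definition self_avoiding v :=
  [forall i, size (arcs_from i v) <= 1]%N && injectiveb (next_vertex v).

Lemma cyclic_set_inj h S : cyclic_set h S ->
  {in S &, injective (next_vertex h)}.
Proof. by case/andP=> _ /eqP hS; apply/imset_injP; rewrite hS. Qed.

Lemma cyclic_set_next h S i : cyclic_set h S ->
  i \in S -> next_vertex h i \in S.
Proof. by case/andP=> _ /eqP hS iS; rewrite -hS imset_f. Qed.

Lemma self_avoiding_top h S : cyclic_set h S -> self_avoiding (top_rows h S).
Proof.
move=> hS; apply/andP; split; first by apply/forallP => i; exact: size_top.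
apply/injectiveP => i j; rewrite !next_top.
case: ifPn => iS; case: ifPn => jS //.
- exact: (cyclic_set_inj hS).
- by move=> ij; rewrite -ij (cyclic_set_next hS iS) in jS.
- by move=> ij; rewrite ij (cyclic_set_next hS jS) in iS.
Qed.

(** If the successor of [i] were outside the support, it would be a fixed point sharing its image
    with [i], against injectivity. *)
Lemma cyclic_set_supp v : self_avoiding v -> cyclic_set v (supp v).
Proof.
case/andP=> _ /injectiveP inj; rewrite /cyclic_set subxx /= eqEcard.
rewrite card_imset // leqnn andbT; apply/subsetP => _ /imsetP[i iv ->].
apply: contraT => ni; have fi := inj _ _ (next_vertex_out ni).
by rewrite fi iv in ni.
Qed.

Lemma cyclic_setM u v S : S \subset supp v ->
  cyclic_set (u * v)%g S = cyclic_set v S.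
Proof.
move=> Sv; rewrite /cyclic_set Sv suppM (subset_trans Sv) ?subsetUr //=.
congr (_ == _); apply: eq_in_imset => i iS; apply: next_vertexM.
exact: (subsetP Sv).
Qed.

(** A right factor with at most one arc per row consists of last arcs of the product, hence is
    recovered from its support alone. *)
Lemma top_rowsM u v : (forall i, size (arcs_from i v) <= 1)%N ->
  top_rows (u * v)%g (supp v) = v.
Proof.
move=> v1; apply: trace_rowsP => i; rewrite arcs_from_top arcs_fromM inE.
have := v1 i; case: (arcs_from i v) => [//|a []] // _.
by rewrite size_cat addn1 drop_size_cat.
Qed.

(** Links the rotation used to define [simple_cycle] with the orbits of [next_vertex]. *)
Lemma fcycle_rot (T : eqType) (f : T -> T) (p : seq T) :
  fcycle f p = (map f p == rot 1 p).
Proof.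
case: p => // x q; rewrite rot1_cons /=.
have fpath_map y r : path (frel f) y r = (map f (belast y r) == r).
  by elim: r y => //= z r IH y; rewrite eqseq_cons IH.
by rewrite fpath_map belast_rcons.
Qed.

Lemma filter_source_uniq w a : uniq (map (@source N E) w) -> a \in w ->
  [seq b <- w | source b == source a] = [:: a].
Proof.
elim: w => //= b w IH /andP[bw uw]; rewrite inE => /predU1P[ab|aw].
  subst b; rewrite eqxx filter_none // => c cw.
  by apply: contra bw => /eqP <-; exact: map_f.
rewrite ifN ?IH //; apply: contra bw => /eqP ->; exact: map_f.
Qed.

Section SimpleCycle.
Variables (w : seq (Defs.arc E)).
Hypotheses (uw : uniq (map (@source N E) w))
  (cw : map (@target N E) w = rot 1 (map (@source N E) w)).
Let c := word_trace w.

Lemma supp_simple_cycle : supp c =i map (@source N E) w.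
Proof.
move=> i; rewrite inE arcs_from_word -has_filter.
by apply/hasP/mapP => [[a aw /eqP <-]|[a aw ->]]; exists a.
Qed.

Lemma next_simple_cycle a : a \in w -> next_vertex c (source a) = target a.
Proof.
by move=> aw; rewrite /next_vertex arcs_from_word filter_source_uniq.
Qed.

Lemma fcycle_simple_cycle : fcycle (next_vertex c) (map (@source N E) w).
Proof.
rewrite fcycle_rot -cw -map_comp; apply/eqP/eq_in_map => a aw /=.
exact: next_simple_cycle.
Qed.

Lemma self_avoiding_simple_cycle : self_avoiding c.
Proof.
have c1 i : (size (arcs_from i c) <= 1)%N.
  have [|] := boolP (i \in supp c).
    rewrite supp_simple_cycle => /mapP[a aw ->].
    by rewrite arcs_from_word filter_source_uniq.
  by rewrite inE negbK => /eqP ->.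
(* The trace [c] is its own top part, so it is enough that its support is a cyclic set. *)
rewrite -(top_rowsM 1%g c1) mul1g; apply: self_avoiding_top.
rewrite /cyclic_set subxx /=; apply/eqP/setP => i.
have := fcycle_simple_cycle; rewrite fcycle_rot => /eqP nc.
rewrite supp_simple_cycle -(mem_rot 1) -nc.
apply/imsetP/mapP => -[j jc ->]; exists j => //.
  by rewrite -supp_simple_cycle.
by rewrite supp_simple_cycle.
Qed.

Lemma is_hike_simple_cycle : c \in @is_hike N E.
Proof.
rewrite is_hike_word; apply/forallP => i.
have := permP (permEl (perm_rot 1 (map (@source N E) w))) (pred1 i).
by rewrite -cw !count_map => /eqP; rewrite eq_sym.
Qed.

(** On the support of [c] the last arcs of the product are those of [c]. Starting from [i] and
    following them runs through the whole cycle without leaving [S]. *)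
Lemma simple_cycle_sub u S i : next_vertex (u * c)%g @: S = S -> i \in S ->
  i \in supp c -> supp c \subset S.
Proof.
move=> nS iS ic; apply/subsetP => j jc.
have /iter_findex <- : fconnect (next_vertex c) i j.
  by rewrite (fconnect_cycle fcycle_simple_cycle) -supp_simple_cycle.
move: (findex _ _ _) => n.
suff /andP[] : (iter n (next_vertex c) i \in S) &&
    (iter n (next_vertex c) i \in supp c) by [].
elim: n => [|n /andP[nS' nc]] /=; first by rewrite iS.
rewrite (cyclic_set_next (cyclic_set_supp self_avoiding_simple_cycle) nc) andbT.
by rewrite -(next_vertexM u nc) -nS imset_f.
Qed.

End SimpleCycle.

(** The orbit of any point of [S] under [next_vertex h] is a cycle made of last arcs, and last arcs
    of distinct rows can be moved to the right end of [h]. *)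
Lemma cyclic_set_simple_cycle h S : cyclic_set h S -> S != set0 ->
  exists u c, simple_cycle c /\ h = (u * c)%g.
Proof.
move=> hS /set0Pn[x xS]; set f := next_vertex h.
have xh : x \in supp h by move: xS; apply/subsetP; case/andP: hS.
have Sf : {in S, forall y, f y \in S} by move=> y; exact: cyclic_set_next.
have oS y : y \in orbit f x -> y \in S.
  rewrite -fconnect_orbit => /iter_findex <-.
  by elim: (findex _ _ _) => //= n; exact: Sf.
have cyc : fcycle f (orbit f x).
  by apply: (cycle_orbit_in Sf (cyclic_set_inj hS)).
have [a0 _] : exists a, a \in arcs_from x h.
  move: xh; rewrite inE; case: arcs_from => // a s _.
  by exists a; rewrite mem_head.
(* The arc [a0] is only a default value: [g] is evaluated on nonempty rows. *)
pose g i := last a0 (arcs_from i h).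
have gh i : i \in supp h ->
  drop (size (arcs_from i h)).-1 (arcs_from i h) = [:: g i].
  rewrite inE /g; case/lastP: (arcs_from i h) => // s a _.
  by rewrite size_rcons last_rcons -cats1 drop_size_cat.
have gE i : i \in supp h -> source (g i) = i /\ target (g i) = f i.
  rewrite inE /f /next_vertex /g => ih.
  have := source_arcs_from i h; move: ih.
  case/lastP: (arcs_from i h) => // s a _.
  by rewrite all_rcons map_rcons !last_rcons => /andP[/eqP ->].
have Sh i : i \in orbit f x -> i \in supp h.
  by move=> /oS; apply/subsetP; case/andP: hS.
pose w := map g (orbit f x).
have ws : map (@source N E) w = orbit f x.
  by rewrite -map_comp map_id_in // => i /Sh /gE[].
exists (rest_rows h [set i in orbit f x]), (word_trace w); split.
  exists w; split=> //.
  - by rewrite -size_eq0 size_map size_orbit -lt0n order_gt0.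
  - by rewrite ws orbit_uniq.
  - rewrite ws -map_comp; move: cyc; rewrite fcycle_rot => /eqP <-.
    by apply/eq_in_map => i /Sh /gE[].
rewrite -[LHS](rest_topK h [set i in orbit f x]); congr (_ * _)%g.
apply: trace_rowsP => i; rewrite arcs_from_top inE arcs_from_word.
case: ifPn => ix; last first.
  rewrite filter_none // => a aw; apply: contra ix => /eqP <-.
  by rewrite -ws map_f.
rewrite gh ?Sh //; have [gi _] := gE i (Sh i ix).
rewrite -[in RHS]gi filter_source_uniq ?gi ?ws ?orbit_uniq //; exact: map_f.
Qed.

(** In a hike a vertex that is entered is also left, so [next_vertex h] maps the support to itself.
    A minimal nonempty stable subset equals its own image. *)
Lemma hike_cyclic_set h : h \in @is_hike N E -> h != 1%g ->
  exists2 S, cyclic_set h S & S != set0.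
Proof.
move=> /forallP hh h1; set f := next_vertex h.
have fh i : i \in supp h -> f i \in supp h.
  rewrite inE /f /next_vertex => ih.
  have : last i (map (@target N E) (arcs_from i h))
      \in map (@target N E) (repr h).
    have sub : {subset map (@target N E) (arcs_from i h)
        <= map (@target N E) (repr h)}.
      by move=> _ /mapP[a + ->]; rewrite mem_filter => /andP[_ ?]; apply: map_f.
    apply: sub; case: (arcs_from i h) ih => //= a s _.
    exact: mem_last.
  move: (last _ _) => j /mapP[a ah ja]; rewrite inE -has_filter has_count.
  by rewrite (eqP (hh j)) -has_count; apply/hasP; exists a => //=; rewrite ja.
pose p S := [&& S != set0, S \subset supp h & f @: S \subset S].
have /ex_minset[S /minsetP[/and3P[S0 Sh fS] minS]] : exists S, p S.
  exists (supp h); rewrite /p supp_eq0 h1 subxx.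
  by apply/subsetP => _ /imsetP[i ih ->]; exact: fh.
exists S => //; rewrite /cyclic_set Sh /=; apply/eqP; apply: minS => //.
by rewrite /p imset_eq0 S0 (subset_trans fS Sh) imsetS.
Qed.

End Cycles.

(** * Coefficients, inverses and row products of formal series *)

Section SeriesFacts.
Variables (K : comNzRingType) (N : nat) (E : {set 'I_N * 'I_N}).
Local Notation FS := (formal_series K E).
Implicit Types (f g : FS) (m u v : trace E).

Lemma series1E m : (1 : FS) m = (m == 1%g)%:R.
Proof. by []. Qed.

Lemma series_sumE (I : Type) (r : seq I) (P : pred I) (F : I -> FS) m :
  (\sum_(i <- r | P i) F i) m = \sum_(i <- r | P i) F i m.
Proof. by apply: (big_morph (fun f : FS => f m)). Qed.

(** By right cancellation [v0] determines [u0], so a single term of the double sum survives. *)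
Lemma sum_factors_right (F : trace E -> trace E -> K) n m u0 v0 :
  (ell m <= n)%N -> (u0 * v0)%g = m ->
  (forall u v, (u * v)%g = m -> v != v0 -> F u v = 0) ->
  \sum_(u <- trace_ball E n) \sum_(v <- trace_ball E n | (u * v)%g == m) F u v
  = F u0 v0.
Proof.
move=> mn uv0 F0.
have le u v : (u * v)%g = m -> (ell u <= n)%N && (ell v <= n)%N.
  by move=> uv; move: mn; rewrite -uv ellM => /[dup] /(leq_trans (leq_addr _ _))
     -> /(leq_trans (leq_addl _ _)) ->.
have /andP[u0n v0n] := le _ _ uv0.
rewrite (bigD1_seq u0) ?trace_ball_mem ?trace_ball_uniq //=.
rewrite [X in _ + X]big1 ?addr0 => [|u uu0]; last first.
  apply: big1 => v /eqP uv; apply: F0 => //; apply: contra uu0 => /eqP vv0.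
  by apply/eqP; apply: (@trace_mulIg _ _ _ _ v0); rewrite uv0 -vv0.
rewrite big_mkcond (bigD1_seq v0) ?trace_ball_mem ?trace_ball_uniq //=.
rewrite uv0 eqxx big1 ?addr0 // => v vv0; case: eqP => // uv; exact: F0.
Qed.

Lemma seriesM_right f g m u0 v0 : (u0 * v0)%g = m ->
  (forall u v, (u * v)%g = m -> v != v0 -> f u * g v = 0) ->
  (f * g) m = f u0 * g v0.
Proof.
move=> uv0 fg0; rewrite (@seriesME _ _ _ (ell m)) //.
exact: (sum_factors_right (F := fun u v => f u * g v)).
Qed.

Lemma seriesXE_small f k m : f 1%g = 0 -> (ell m < k)%N -> (f ^+ k) m = 0.
Proof.
move=> f1; elim: k m => // k IH m mk.
rewrite exprS (@seriesME _ _ _ (ell m)) //.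
apply: big1 => u _; apply: big1 => v /eqP uv.
have [->|u1] := eqVneq u 1%g; first by rewrite f1 mul0r.
rewrite IH ?mulr0 //; rewrite -ltnS; apply: leq_trans mk.
by rewrite -uv ellM ltnS -[X in (X < _)%N]add0n ltn_add2r lt0n ell_eq0.
Qed.

(* Inverse by the geometric series in [1 - f], whose [k]-th power vanishes on
   traces shorter than [k]. *)
Lemma series_unit1 f : f 1%g = 1 -> f \is a GRing.unit.
Proof.
move=> f1; pose e := 1 - f.
have e1 : e 1%g = 0.
  by rewrite [LHS]/((1 : FS) 1%g - f 1%g) f1 series1E eqxx; exact: subrr.
pose G n : FS := \sum_(k < n.+1) e ^+ k.
(* The truncation varies with the trace; at [m] all [G n] with [ell m <= n] agree. *)
pose g : FS := fun m => G (ell m) m.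
have gG n m : (ell m <= n)%N -> g m = G n m.
  move=> mn; rewrite /g /G !series_sumE.
  rewrite (big_ord_widen n.+1 (fun k => (e ^+ k) m)) ?ltnS //.
  rewrite big_mkcond; apply: eq_bigr => k _.
  by rewrite ltnS; case: leqP => // mk; rewrite seriesXE_small.
have fe : f = 1 - e by rewrite /e opprB addrC subrK.
have fG n : f * G n = 1 - e ^+ n.+1.
  by rewrite fe -[RHS]opprB subrX1 -mulNr (opprB e).
have cfe : GRing.comm f e.
  rewrite fe; apply: commr_sym.
  exact: commrB (commr1 e) (commr_refl e).
have Gf n : G n * f = f * G n.
  rewrite /G mulr_suml mulr_sumr; apply: eq_bigr => k _.
  exact: esym (commrX k cfe).
have fG1 m : (f * G (ell m)) m = (1 : FS) m.
  rewrite fG [LHS]/((1 : FS) m - (e ^+ (ell m).+1) m).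
  by rewrite (seriesXE_small e1) //; exact: subr0.
(* A coefficient of a product at [m] only involves coefficients at traces no longer than [m], so [g]
   may be replaced by the polynomial [G (ell m)]. *)
have swap (F H F' H' : FS) m :
    (forall x, (ell x <= ell m)%N -> F x = F' x) ->
    (forall x, (ell x <= ell m)%N -> H x = H' x) -> (F * H) m = (F' * H') m.
  move=> FF HH; rewrite !(@seriesME _ _ _ (ell m)) // big_seq [RHS]big_seq.
  apply: eq_bigr => u; rewrite trace_ball_mem => um.
  rewrite big_seq_cond [RHS]big_seq_cond; apply: eq_bigr => v /andP[].
  by rewrite trace_ball_mem; move=> vm _; rewrite FF // HH.
apply/unitrP; exists g; split; apply/funext => m.
- by rewrite (swap _ _ (G (ell m)) f) ?Gf ?fG1 // => x; exact: gG.
- by rewrite (swap _ _ f (G (ell m))) ?fG1 // => x; exact: gG.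
Qed.

(** The factors of a nonzero term lie in distinct single rows, so only the factorization of [m] into
    its rows contributes, and it needs every nonempty row to be listed in [r]. *)
Lemma prod_rowsE (F : 'I_N -> FS) (r : seq 'I_N) m : uniq r ->
  (forall i x, ~~ (supp x \subset [set i]) -> F i x = 0) ->
  (\prod_(i <- r) F i) m =
  if supp m \subset r then \prod_(i <- r) F i (word_trace (arcs_from i m))
  else 0.
Proof.
move=> + F0; elim: r m => [|i r IH] m.
  rewrite !big_nil series1E -supp_eq0 -subset0 => _.
  have -> : (supp m \subset [::]) = (supp m \subset set0).
    by apply: eq_subset_r => j; rewrite inE.
  by case: ifP.
case/andP=> ir ur.
(* This is [m] with row [i] emptied, the only possible right cofactor of a word in row [i]. *)
pose v0 := of_rows (fun j => if j == i then [::] else arcs_from j m).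
have v0E j : arcs_from j v0 = if j == i then [::] else arcs_from j m.
  by rewrite arcs_from_of_rows // => k; case: ifP => // _; exact: filter_all.
have iE j : arcs_from j (word_trace (arcs_from i m)) =
    if j == i then arcs_from i m else [::].
  by rewrite arcs_from_word (filter_source j (source_arcs_from i m)).
have uv0 : (word_trace (arcs_from i m) * v0)%g = m.
  apply: trace_rowsP => j; rewrite arcs_fromM iE v0E.
  by case: eqP => [->|]; rewrite ?cats0.
rewrite !big_cons (seriesM_right uv0) => [|u v uv vv0]; last first.
  have [ui|/F0 ->] := boolP (supp u \subset [set i]); last by rewrite mul0r.
  rewrite IH //; case: ifP => [vr|_]; last by rewrite mulr0.
  case/eqP: vv0; apply: trace_rowsP => j; rewrite v0E -uv arcs_fromM.
  case: eqP => [->|/eqP ji].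
    apply/eqP; apply: contraR ir => iv; apply: (subsetP vr).
    by rewrite inE.
  have : j \notin supp u by apply: contra ji => /(subsetP ui); rewrite inE.
  by rewrite inE negbK => /eqP ->.
rewrite IH //.
have -> : (supp v0 \subset r) = (supp m \subset i :: r).
  apply/subsetP/subsetP => sr j; have := sr j; rewrite !inE v0E.
    by have [|] := eqVneq j i.
  by have [|] := eqVneq j i.
case: ifP; rewrite ?mulr0 // => _; congr (_ * _); apply: eq_big_seq => j jr.
by rewrite v0E ifN //; apply: contra ir => /eqP <-.
Qed.

End SeriesFacts.

(** * The permanent and the coefficients of its inverse *)

Section Permanent.
Variables (K : comNzRingType) (N : nat) (E : {set 'I_N * 'I_N}) (z : K).
Local Notation FS := (formal_series K E).
Implicit Types (m u v h c : trace E) (S C : {set 'I_N}).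
Let A : 'M[FS]_N := 1%:M + map_mx ( *:%R z) (adjacency K E).

Lemma weighted_entryE i j m : A i j m =
  (if i == j then (m == 1%g)%:R else 0) +
  z * (if insub (i, j) is Some a then (m == word_trace [:: a])%:R else 0).
Proof.
rewrite !mxE; case: (insub _) => [a|]; case: eqP => _; exact: erefl.
Qed.

Lemma weighted_entry_out i j m : ~~ (supp m \subset [set i]) -> A i j m = 0.
Proof.
move=> mi; rewrite weighted_entryE.
have -> : (m == 1%g) = false.
  by apply: contraNF mi; rewrite -supp_eq0 => /eqP ->; rewrite sub0set.
rewrite if_same add0r; case: insubP => [a _ aij|_]; rewrite ?mulr0 //.
case: eqP => [ma|]; rewrite ?mulr0 //; case/negP: mi; rewrite ma.
apply/subsetP => k; rewrite !inE arcs_from_word /=.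
by rewrite /source aij /=; have [|] := eqVneq i k.
Qed.

(** An empty row sees only the identity matrix, where the junk value of [next_vertex] is the
    diagonal index. A single arc sees only the adjacency matrix, and longer rows see neither. *)
Lemma weighted_entry_row i j m : A i j (word_trace (arcs_from i m)) =
  if (size (arcs_from i m) <= 1)%N && (j == next_vertex m i)
  then z ^+ size (arcs_from i m) else 0.
Proof.
rewrite weighted_entryE /next_vertex.
have wP (s : seq (Defs.arc E)) : all (fun a => source a == i) s ->
    (word_trace (arcs_from i m) == word_trace s) = (arcs_from i m == s).
  move=> si; apply/eqP/eqP => [/(congr1 (arcs_from i))|-> //].
  by rewrite !arcs_from_word !(@filter_source _ _ i i) ?eqxx ?source_arcs_from.
rewrite (wP [::]) //.
have -> : (if insub (i, j) is Some a
    then (word_trace (arcs_from i m) == word_trace [:: a])%:R else 0) =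
    (if insub (i, j) is Some a then (arcs_from i m == [:: a])%:R else 0) :> K.
  case: insubP => // a _ aij; rewrite wP //=.
  by rewrite /source aij /= eqxx.
have := source_arcs_from i m.
case: (arcs_from i m) => [|a [|b s]] /= => [_|/andP[/eqP ai _]|_].
- rewrite (eq_sym j) expr0; case: insub => [a|] /=; rewrite mulr0 addr0 //.
- rewrite if_same add0r expr1; case: insubP => [b _ bij|ij].
    rewrite eqseq_cons andbT -(inj_eq val_inj) bij.
    have -> : val a = (i, target a).
      by rewrite -ai /source /target; case: (val a).
    rewrite xpair_eqE eqxx /= eq_sym; by case: eqP; rewrite ?mulr1 ?mulr0.
  rewrite mulr0; case: eqP => // ja; case/negP: ij.
  by rewrite ja -ai; case: (a) => -[].
- rewrite if_same add0r.
  by case: insub => [c|]; rewrite ?eqseq_cons ?andbF mulr0.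
Qed.

Lemma permanentE m :
  (permanent A : FS) m = if self_avoiding m then z ^+ ell m else 0.
Proof.
rewrite /permanent series_sumE.
have prodE (s : 'S_N) : (\prod_(i < N) A i (s i)) m = \prod_(i < N)
    (if (size (arcs_from i m) <= 1)%N && (s i == next_vertex m i)
     then z ^+ size (arcs_from i m) else 0).
  rewrite (prod_rowsE (F := fun i => A i (s i)) m (index_enum_uniq _));
    last by move=> i x; exact: weighted_entry_out.
  rewrite ifT; last by apply/subsetP => i _; rewrite mem_index_enum.
  by apply: eq_bigr => i _; exact: weighted_entry_row.
rewrite (eq_bigr _ (fun s _ => prodE s)).
case: ifPn => [/andP[/forallP m1 /injectiveP inj]|nsa].
  (* Only the permutation given by [next_vertex m] has all its row factors nonzero. *)
  rewrite (bigD1 (perm inj)) //= [X in _ + X]big1 ?addr0 => [|s snext].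
    under eq_bigr do rewrite m1 permE eqxx /=.
    by rewrite prodrXr -ell_rows.
  have [i si] : exists i, s i != next_vertex m i.
    apply/existsP; apply: contraR snext; rewrite negb_exists => /forallP H.
    apply/eqP/perm.permP => i; rewrite permE; apply/eqP.
    by rewrite -[_ == _]negbK.
  by rewrite (bigD1 i) //= (negbTE si) andbF mul0r.
(* If no row factor vanished, [next_vertex m] would coincide with [s] and be injective, making [m]
   self-avoiding. *)
apply: big1 => s _.
have [i si] : exists i,
    ~~ ((size (arcs_from i m) <= 1)%N && (s i == next_vertex m i)).
  apply/existsP; apply: contraR nsa; rewrite negb_exists => /forallP H.
  have {}H i : (size (arcs_from i m) <= 1)%N && (s i == next_vertex m i).
    by rewrite -[_ && _]negbK.
  apply/andP; split; first by apply/forallP => i; case/andP: (H i).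
  apply/injectiveP => i j; case/andP: (H i) => _ /eqP <-.
  by case/andP: (H j) => _ /eqP <-; exact: perm_inj.
by rewrite (bigD1 i) //= (negbTE si) mul0r.
Qed.

Lemma permanent1 : (permanent A : FS) 1%g = 1.
Proof.
rewrite permanentE ell1 ifT //; apply/andP; split.
  by apply/forallP => i; rewrite arcs_from1.
by apply/injectiveP => i j; rewrite /next_vertex !arcs_from1.
Qed.

Lemma permanent_unit : (permanent A : FS) \is a GRing.unit.
Proof. exact/series_unit1/permanent1. Qed.

Lemma seriesM_permanent (f : FS) h : (f * permanent A) h =
  \sum_(S | cyclic_set h S) z ^+ ell (top_rows h S) * f (rest_rows h S).
Proof.
rewrite (@seriesME _ _ _ (ell h)) //.
(* An inner sum over cyclic sets is inserted: for self-avoiding [v] only [S = supp v] contributes,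
   and otherwise no [S] does. *)
transitivity (\sum_(u <- trace_ball E (ell h))
    \sum_(v <- trace_ball E (ell h) | (u * v)%g == h) \sum_(S | cyclic_set h S)
    (if v == top_rows h S then z ^+ ell v * f u else 0)).
  apply: eq_bigr => u _; apply: eq_bigr => v /eqP uv.
  rewrite permanentE; case: ifPn => [sv|nsv]; last first.
    rewrite mulr0 big1 // => S hS; case: eqP => // vS.
    by rewrite vS self_avoiding_top in nsv.
  have topv : top_rows h (supp v) = v.
    by rewrite -uv top_rowsM //; apply/forallP; case/andP: sv.
  have hv : cyclic_set h (supp v) by rewrite -uv cyclic_setM ?cyclic_set_supp.
  rewrite (bigD1 (supp v)) //= topv eqxx mulrC big1 ?addr0 // => S.
  case/andP=> hS nS; case: eqP => // vS; case/eqP: nS.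
  by rewrite vS supp_top //; case/andP: hS.
under eq_bigr do rewrite exchange_big /=.
rewrite exchange_big /=; apply: eq_bigr => S hS.
rewrite (sum_factors_right (leqnn _) (rest_topK h S)) ?eqxx //.
by move=> u v _ /negbTE ->.
Qed.

Let Q : FS := (permanent A)^-1.

Lemma permanent_inv1 : Q 1%g = 1.
Proof.
have := congr1 (@^~ 1%g) (mulVr permanent_unit).
rewrite (@seriesM_right _ _ _ _ _ _ 1%g 1%g) ?mul1g // => [|u v].
  by rewrite permanent1 mulr1 series1E eqxx.
move=> /(congr1 (@ell _ _)) /eqP uv v1; move: uv; rewrite ellM ell1.
by rewrite addn_eq0 !ell_eq0 (negbTE v1) andbF.
Qed.

Lemma permanent_inv_sum h : h != 1%g ->
  \sum_(S | cyclic_set h S) z ^+ ell (top_rows h S) * Q (rest_rows h S) = 0.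
Proof.
move=> /negbTE h1.
by rewrite -seriesM_permanent mulVr ?permanent_unit // series1E h1.
Qed.

Lemma top_rows0 h : top_rows h set0 = 1%g.
Proof. by apply: trace_rowsP => i; rewrite arcs_from_top inE arcs_from1. Qed.

Lemma rest_rows0 h : rest_rows h set0 = h.
Proof. by rewrite -[RHS](rest_topK h set0) top_rows0 mulg1. Qed.

Lemma cyclic_set0 h : cyclic_set h set0.
Proof. by rewrite /cyclic_set sub0set imset0 eqxx. Qed.

Lemma permanent_inv_cycle u c : simple_cycle c ->
  Q (u * c)%g = - z ^+ ell c * Q u.
Proof.
case=> w [w0 uw cw ->]; set c0 := word_trace w.
have [n] := ubnP (ell u); elim: n u => // n IH u; rewrite ltnS => un.
set h := (u * c0)%g; set C := supp c0.
have sa : self_avoiding c0 by exact: self_avoiding_simple_cycle.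
have c1 i : (size (arcs_from i c0) <= 1)%N by case/andP: sa => /forallP.
have c01 : c0 != 1%g by rewrite -ell_eq0 ell_word size_eq0.
have hC : cyclic_set h C by rewrite cyclic_setM ?cyclic_set_supp.
have topC : top_rows h C = c0 by exact: top_rowsM.
have C0 : C != set0 by rewrite supp_eq0.
have disj S : cyclic_set h S -> ~~ (C \subset S) -> [disjoint S & C].
  case/andP=> _ /eqP nS; apply: contraR => /pred0Pn[i /andP[/= iS iC]].
  exact: (simple_cycle_sub uw cw nS iS iC).
have h1 : h != 1%g.
  by rewrite -ell_eq0 ellM addn_eq0 !ell_eq0 (negbTE c01) andbF.
have topU S : [disjoint S & C] ->
    top_rows h (S :|: C) = (c0 * top_rows h S)%g.
  move=> SC; rewrite -topC; apply: trace_rowsP => i.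
  rewrite arcs_fromM !arcs_from_top in_setU.
  case: ifP => [|/norP[/negbTE -> /negbTE -> //]].
  case: (boolP (i \in S)) => [iS _|_ /= ->]; last by rewrite cats0.
  by rewrite (disjointFr SC iS).
(* Both sides give [h] after multiplication by [top_rows h S] on the right. *)
have restU S : [disjoint S & C] ->
    rest_rows h S = (rest_rows h (S :|: C) * c0)%g.
  move=> SC; apply: (@trace_mulIg _ _ _ _ (top_rows h S)).
  by rewrite -mulgA -topU // !rest_topK.
have := permanent_inv_sum h1.
rewrite (bigID (fun S => C \subset S)) /=.
(* Sets containing [C] are written as [S :|: C] with [S] disjoint from [C]; both halves of the sum
   then run over the same sets [S]. *)
rewrite (reindex_onto (fun S => S :|: C) (fun S => S :\: C)) /=; last first.
  by move=> S /andP[_ CS]; rewrite setUC -[X in X :|: _](setIidPr CS) setID.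
rewrite (eq_bigl (fun S => cyclic_set h S && ~~ (C \subset S))); last first.
  move=> S; rewrite subsetUr andbT setDUl setDv setU0.
  have -> : (S :\: C == S) = [disjoint S & C].
    by apply/eqP/idP => [/setDidPl|/setDidPl].
  apply/andP/andP => [[hSC SC]|[hS nCS]]; last first.
    split; last exact: disj.
    case/andP: hS => Sh /eqP nS; case/andP: hC => Ch /eqP nC.
    by rewrite /cyclic_set subUset Sh Ch imsetU nS nC eqxx.
  (* Removing [C] keeps the set cyclic: [C] is its own image, so by injectivity no point of [S] is
     sent into [C]. *)
  have inj := cyclic_set_inj hSC; split.
    have Sh : S \subset supp h.
      by case/andP: hSC => /(subset_trans (subsetUl _ _)) ->.
    rewrite /cyclic_set Sh /= eqEcard card_in_imset ?leqnn ?andbT; last first.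
      by move=> i j iS jS; apply: inj; rewrite in_setU ?iS ?jS.
    apply/subsetP => _ /imsetP[i iS ->].
    have : next_vertex h i \in S :|: C.
      by apply: (cyclic_set_next hSC); rewrite in_setU iS.
    rewrite in_setU => /orP[//|]; case/andP: (hC) => _ /eqP {1}<-.
    case/imsetP => j jC /inj ij.
    have {}ij : i = j by apply: ij; rewrite in_setU ?iS ?jC ?orbT.
    by rewrite -ij (disjointFr SC iS) in jC.
  apply: contra C0 => CS; move: SC; rewrite disjoint_sym => /setDidPl <-.
  by rewrite setD_eq0.
rewrite -big_split (bigD1 set0) ?cyclic_set0 ?subset0 //=.
rewrite big1 => [|S /andP[/andP[hS nCS] S0]]; last first.
  have SC := disj _ hS nCS.
  (* As [S] is nonempty, what remains of [h] without the rows' last arcs in [S :|: C] is shorter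
     than [u]. The induction hypothesis makes the terms of [S] and [S :|: C] opposite. *)
  rewrite (restU _ SC) IH; last first.
    apply: leq_trans un; rewrite -(ltn_add2r (ell c0)) -!ellM -/h.
    rewrite -restU // -[in ltnRHS](rest_topK h S) ellM -[ltnLHS]addn0 ltn_add2l.
    by rewrite lt0n ell_eq0 -supp_eq0 supp_top //; case/andP: hS.
  rewrite topU // ellM exprD.
  by rewrite mulNr mulrN mulrA [X in _ - X * _]mulrC addrN.
(* The pair of [set0] and [C] is left, and its vanishing is the claim. *)
rewrite addr0 set0U top_rows0 rest_rows0 ell1 expr0 mul1r topC.
have -> : rest_rows h C = u.
  by apply: (@trace_mulIg _ _ _ _ c0); rewrite -[in LHS]topC rest_topK.
by move=> /eqP; rewrite addrC addr_eq0 mulNr => /eqP.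
Qed.

Lemma permanent_inv_prod cs : (forall c, c \in cs -> simple_cycle c) ->
  Q (\prod_(c <- cs) c)%g =
  (-1) ^+ size cs * z ^+ ell (\prod_(c <- cs) c)%g.
Proof.
elim/last_ind: cs => [|cs c IH] H.
  by rewrite big_nil permanent_inv1 ell1 mulr1.
rewrite -cats1 big_cat big_seq1 /= permanent_inv_cycle ?IH.
- rewrite size_cat addn1 exprS ellM exprD.
  by rewrite mulN1r !mulNr mulrCA [X in _ * X]mulrC.
- by move=> d dcs; apply: H; rewrite mem_rcons inE dcs orbT.
- by apply: H; rewrite mem_rcons mem_head.
Qed.

(** If a simple cycle divides [m] on the right, the quotient is again not a hike and induction
    applies. Otherwise [set0] is the only cyclic set and the vanishing sum reduces to [Q m]. *)
Lemma permanent_inv_out m : m \notin @is_hike N E -> Q m = 0.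
Proof.
have [n] := ubnP (ell m); elim: n m => // n IH m; rewrite ltnS => mn nm.
have m1 : m != 1%g by apply: contraNneq nm => ->; exact: is_hike1.
have [/existsP[S /andP[hS S0]]|/existsPn noS] :=
    boolP [exists S, cyclic_set m S && (S != set0)].
  have [u [c [cc muc]]] := cyclic_set_simple_cycle hS S0.
  rewrite muc permanent_inv_cycle // IH ?mulr0 //.
    apply: leq_trans mn; rewrite muc ellM -[ltnLHS]addn0 ltn_add2l.
    by case: cc => w [w0 _ _ ->]; rewrite ell_word lt0n size_eq0.
  apply: contra nm => uh; rewrite muc; apply: is_hikeM => //.
  by case: cc => w [_ _ cw ->]; exact: is_hike_simple_cycle.
have := permanent_inv_sum m1; rewrite (bigD1 set0) ?cyclic_set0 //=.
rewrite top_rows0 rest_rows0 ell1 mul1r big1 ?addr0 // => S /andP[hS S0].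
by have := noS S; rewrite hS S0.
Qed.

End Permanent.

(** * Existence of prime factorizations *)

Lemma is_hike_divl (N : nat) (E : {set 'I_N * 'I_N}) (u c : trace E) :
  (u * c)%g \in @is_hike N E -> c \in @is_hike N E -> u \in @is_hike N E.
Proof.
elim/quotW: u => u; elim/quotW: c => v.
rewrite -!/(word_trace _) word_traceM !is_hike_word.
move=> /forallP huv /forallP hv; apply/forallP => i.
by have := huv i; rewrite !count_cat (eqP (hv i)) eqn_add2r.
Qed.

Lemma prime_factorization_exists (N : nat) (E : {set 'I_N * 'I_N})
  (h : hike E) : exists cs, prime_factorization h cs.
Proof.
case: h => m hm; rewrite /prime_factorization /=.
have [n] := ubnP (ell m); elim: n m hm => // n IH m hm; rewrite ltnS => mn.
have [->|m1] := eqVneq m 1%g; first by exists [::]; rewrite big_nil.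
have [S hS S0] := hike_cyclic_set hm m1.
have [u [c [cc muc]]] := cyclic_set_simple_cycle hS S0.
have [w [w0 uw cw cE]] := cc.
have [||cs [cs_cycles csE]] := IH u.
- apply: (@is_hike_divl _ _ u c); first by rewrite -muc.
  by rewrite cE; exact: is_hike_simple_cycle.
- apply: leq_trans mn; rewrite muc ellM -[ltnLHS]addn0 ltn_add2l.
  by rewrite cE ell_word lt0n size_eq0.
exists (rcons cs c); split; last by rewrite -cats1 big_cat big_seq1 /= csE muc.
by move=> d; rewrite mem_rcons inE => /predU1P[-> //|]; exact: cs_cycles.
Qed.

(** Existence of a factorization rules out the default value in [Omega]. *)
Lemma Omega_factorization (N : nat) (E : {set 'I_N * 'I_N}) (h : hike E) :
  exists2 cs, prime_factorization h cs & Omega h = size cs.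
Proof.
rewrite /Omega; case: xgetP => [cs _ hcs|none]; first by exists cs.
by have [cs hcs] := prime_factorization_exists h; case: (none cs).
Qed.

(** * Multiplicativity of the complex exponential *)

Section ComplexExponential.
Variable R : realType.
Implicit Types x y : R[i].

Lemma cexp0 : cexp (0 : R[i]) = 1.
Proof. by rewrite /cexp /= expR0 cos0 sin0 mul1r. Qed.

Lemma cexpD x y : cexp (x + y) = cexp x * cexp y.
Proof.
case: x y => [a b] [c d]; rewrite /cexp /= expRD cosD sinD.
apply/eqP; rewrite eq_complex /= !mul0r !subr0 !addr0.
by apply/andP; split; apply/eqP; ring.
Qed.

Lemma cexpMn x (n : nat) : cexp (x * n%:R) = cexp x ^+ n.
Proof.
elim: n => [|n IH]; first by rewrite mulr0 cexp0.
by rewrite mulrS mulrDr mulr1 cexpD IH exprS.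
Qed.

End ComplexExponential.

Theorem proposition3p10 (R : realType) (N : nat) (E : {set 'I_N * 'I_N})
    (s : R[i]) :
  let P : formal_series R[i] E :=
    permanent (1%:M + map_mx ( *:%R (cexp (- s))) (adjacency R[i] E)) in
  [/\ dirichlet (@liouville R N E) s =
        hike_series (fun h : hike E =>
          cexp (- s * (ell h)%:R) * (-1) ^+ Omega h),
      P \is a GRing.unit
    & dirichlet (@liouville R N E) s = P^-1].
Proof.
move=> P.
have liouvilleE : dirichlet (@liouville R N E) s =
    hike_series (fun h : hike E => cexp (- s * (ell h)%:R) * (-1) ^+ Omega h).
  rewrite /dirichlet; congr hike_series; apply/funext => h.
  by rewrite /liouville rmorphXn /= rmorphN1.
split=> //; first exact: permanent_unit.
rewrite liouvilleE; apply/funext => m; rewrite /hike_series.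
case: insubP => [h _ hm|nm]; last by rewrite permanent_inv_out.
(* The coefficient of the inverse is known along every factorization, in particular along the one
   that [Omega] has chosen. *)
have [cs [cs_cycles csE] ->] := Omega_factorization h.
have mE : m = (\prod_(c <- cs) c)%g by rewrite csE -hm.
by rewrite -csE mE /P permanent_inv_prod // cexpMn mulrC.
Qed.
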